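(* Let $n\ge 1$ and let $\Delta$ be a local $\frac12$-derivation of the complex Lie algebra $\mathfrak{L}_n$. Then there are complex numbers $a_i,b_i,c_i$ ($1\le i\le n$) such that $\Delta(e_i)=a_ie_i$ and $\Delta(x_i)=b_ie_i+c_ix_i$ for all $1\le i\le n$.
   Context: All algebras are over $\mathbb{C}$. A linear map $D:\mathfrak{L}\to\mathfrak{L}$ on a Lie algebra is a $\frac12$-derivation if $D[x,y]=\frac12\big([D(x),y]+[x,D(y)]\big)$ for all $x,y\in\mathfrak{L}$. A linear map $\Delta:\mathfrak{L}\to\mathfrak{L}$ is a local $\frac12$-derivation if for every $x\in\mathfrak{L}$ there is a $\frac12$-derivation $D_x$ (depending on $x$) with $\Delta(x)=D_x(x)$. $\mathfrak{L}_n$ is the $2n$-dimensional solvable Lie algebra with basis $\{e_1,\dots,e_n,x_1,\dots,x_n\}$ and brackets $[e_i,x_i]=e_i$ for $1\le i\le n$; brackets of basis elements not obtained from these by antisymmetry are zero. (Its nilradical is the abelian ideal spanned by $e_1,\dots,e_n$.) *)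

(* Defs.v *)
From HB Require Import structures.
From mathcomp Require Import all_boot all_order all_algebra.
From mathcomp Require Import reals complex.
From mathcomp Require Import ring.

Set Implicit Arguments.
Unset Strict Implicit.
Unset Printing Implicit Defensive.

Import GRing.Theory.
Local Open Scope ring_scope.

HB.mixin Record Lmodule_isLieAlgebra (K : comNzRingType) L of GRing.Lmodule K L := {
  lie : L -> L -> L;
  lie_linearl : forall y : L, linear (fun x => lie x y);
  lie_linearr : forall x : L, linear (lie x);
  liexx : forall x : L, lie x x = 0;
  lie_jacobi : forall x y z : L,
    lie x (lie y z) + lie y (lie z x) + lie z (lie x y) = 0
}.

#[short(type="lieAlgType")]
HB.structure Definition LieAlgebra (K : comNzRingType) :=
  { L of GRing.Lmodule K L & Lmodule_isLieAlgebra K L }.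

Section HalfDerivations.
Variables (K : fieldType) (L : lieAlgType K).

Definition half_derivation (D : {linear L -> L}) : Prop :=
  forall x y : L, D (lie x y) = 2%:R^-1 *: (lie (D x) y + lie x (D y)).

Definition local_half_derivation (Delta : {linear L -> L}) : Prop :=
  forall x : L, exists D : {linear L -> L}, half_derivation D /\ Delta x = D x.

End HalfDerivations.

(* Coordinates of a row vector of length n + n are taken in the order
   e_1, ..., e_n, x_1, ..., x_n. *)
Definition solvL (K : comNzRingType) (n : nat) : Type := 'rV[K]_(n + n).

HB.instance Definition _ (K : comNzRingType) (n : nat) :=
  GRing.Lmodule.copy (solvL K n) 'rV[K]_(n + n).

Section SolvL.
Variables (K : comNzRingType) (n : nat).
Notation L := (solvL K n).

Definition basisL (p : 'I_(n + n)) : L := delta_mx 0 p.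
Definition eL (i : 'I_n) : L := basisL (lshift n i).
Definition xL (i : 'I_n) : L := basisL (rshift n i).

Definition basis_bracket (p q : 'I_(n + n)) : L :=
  match split p, split q with
  | inl i, inr j => if i == j then eL i else 0
  | inr i, inl j => if i == j then - eL j else 0
  | _, _ => 0
  end.

Definition bracketL (u v : L) : L :=
  \sum_p \sum_q (u 0 p * v 0 q) *: basis_bracket p q.

Lemma bracketLE (u v : L) :
  bracketL u v = \sum_i (u 0 (lshift n i) * v 0 (rshift n i)
                         - u 0 (rshift n i) * v 0 (lshift n i)) *: eL i.
Proof.
have splitl (i : 'I_n) : split (lshift n i) = inl i := unsplitK (inl _ i).
have splitr (i : 'I_n) : split (rshift n i) = inr i := unsplitK (inr _ i).
rewrite /bracketL big_split_ord /= -big_split /=; apply: eq_bigr => i _.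
rewrite !big_split_ord /=.
rewrite [X in X + _ + _]big1 ?add0r => [|j _]; last first.
  by rewrite /basis_bracket !splitl scaler0.
rewrite [X in _ + (_ + X)]big1 ?addr0 => [|j _]; last first.
  by rewrite /basis_bracket !splitr scaler0.
rewrite (bigD1 i) //= big1 ?addr0 => [|j ji]; last first.
  by rewrite /basis_bracket splitl splitr eq_sym (negPf ji) scaler0.
rewrite (bigD1 i) //= big1 ?addr0 => [|j ji]; last first.
  by rewrite /basis_bracket splitl splitr eq_sym (negPf ji) scaler0.
by rewrite /basis_bracket splitl splitr eqxx scalerN scalerBl.
Qed.

Lemma bracketL_e (u v : L) i :
  bracketL u v 0 (lshift n i) =
  u 0 (lshift n i) * v 0 (rshift n i) - u 0 (rshift n i) * v 0 (lshift n i).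
Proof.
rewrite bracketLE summxE (bigD1 i) //= big1 ?addr0 => [|j ji].
  by rewrite !mxE !eqxx mulr1.
by rewrite !mxE eqxx /= (inj_eq (@lshift_inj _ _)) eq_sym (negPf ji) mulr0.
Qed.

Lemma bracketL_x (u v : L) i : bracketL u v 0 (rshift n i) = 0.
Proof.
by rewrite bracketLE summxE big1 // => j _; rewrite !mxE eq_rlshift andbF mulr0.
Qed.

Lemma solvLP (u v : L) :
  (forall i, u 0 (lshift n i) = v 0 (lshift n i)) ->
  (forall i, u 0 (rshift n i) = v 0 (rshift n i)) -> u = v.
Proof.
move=> ee ex; apply/rowP => p; rewrite -(splitK p).
by case: (split p) => i /=; rewrite ?ee ?ex.
Qed.

Lemma bracketL_linearl (y : L) : linear (fun x : L => bracketL x y).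
Proof.
move=> a u v; apply: solvLP => i; rewrite !mxE ?bracketL_e ?bracketL_x.
  by rewrite !mxE; ring.
by rewrite mulr0 addr0.
Qed.

Lemma bracketL_linearr (x : L) : linear (bracketL x).
Proof.
move=> a u v; apply: solvLP => i; rewrite !mxE ?bracketL_e ?bracketL_x.
  by rewrite !mxE; ring.
by rewrite mulr0 addr0.
Qed.

Lemma bracketLxx (x : L) : bracketL x x = 0.
Proof.
apply: solvLP => i; rewrite ?bracketL_e ?bracketL_x !mxE //.
by rewrite mulrC subrr.
Qed.

Lemma bracketL_jacobi (x y z : L) :
  bracketL x (bracketL y z) + bracketL y (bracketL z x)
  + bracketL z (bracketL x y) = 0.
Proof.
apply: solvLP => i; rewrite !mxE ?bracketL_x ?addr0 //.
by rewrite !bracketL_e !bracketL_x; ring.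
Qed.

HB.instance Definition _ := Lmodule_isLieAlgebra.Build K L
  bracketL_linearl bracketL_linearr bracketLxx bracketL_jacobi.

Lemma lie_basisL (p q : 'I_(n + n)) :
  lie (basisL p) (basisL q) = basis_bracket p q.
Proof.
rewrite [LHS](_ : _ = bracketL (basisL p) (basisL q)) // /bracketL.
rewrite (bigD1 p) //= [X in _ + X]big1 ?addr0 => [|r rp]; last first.
  by rewrite big1 // => s _; rewrite !mxE (negPf rp) mul0r scale0r.
rewrite (bigD1 q) //= big1 ?addr0 => [|s sq]; last first.
  by rewrite !mxE (negPf sq) mulr0 scale0r.
by rewrite !mxE !eqxx mulr1 scale1r.
Qed.

End SolvL.

(* Main.v *)
Require Import Defs.
From mathcomp Require Import all_boot all_order all_algebra.
From mathcomp Require Import reals complex.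

Import GRing.Theory.
Local Open Scope ring_scope.

(** The algebra is the direct sum of its planes <e_i, x_i>, each a copy of the
    centerless two-dimensional algebra.  The asserted form of Delta already holds
    for every half-derivation D, and it is a condition on the value at a single
    basis vector, so Delta inherits it: its value at that vector is also the
    value of some half-derivation there.

    For D the reason is as follows.  If [u, v] = 0, then
    [D u, v] + [u, D v] = 0.  Take u in the i-th plane and v in the j-th one,
    with i <> j: the second bracket lies in the i-th plane, so the j-th component
    of the first must vanish.  Hence the j-th component of D u commutes with the
    whole j-th plane and is zero.  So D preserves every plane; this is
    [half_derivation_x_eq0] and [half_derivation_e_eq0].  Finally, D e_i is a
    combination of brackets because e_i = [e_i, x_i] is one, so it lies in the
    nilradical and has no x-component; this is [half_derivation_lie_x]. *)

Lemma half_derivation_commute (K : fieldType) (L : lieAlgType K)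
    (D : {linear L -> L}) (u v : L) :
  2%:R != 0 :> K -> half_derivation D -> lie u v = 0 ->
  lie (D u) v + lie u (D v) = 0.
Proof.
move=> two_neq0 halfD uv0; have /esym/eqP := halfD u v.
by rewrite uv0 linear0 scaler_eq0 invr_eq0 (negPf two_neq0) => /eqP.
Qed.

Section HalfDerivationsOfSolvL.
Variables (K : fieldType) (n : nat).
Local Notation L := (solvL K n).
Implicit Types (u v : L) (i j : 'I_n).

Lemma lie_e u v i :
  lie u v 0 (lshift n i) =
  u 0 (lshift n i) * v 0 (rshift n i) - u 0 (rshift n i) * v 0 (lshift n i).
Proof. exact: bracketL_e. Qed.

Lemma lie_x u v i : lie u v 0 (rshift n i) = 0.
Proof. exact: bracketL_x. Qed.

Lemma eL_e i j : eL K i 0 (lshift n j) = (j == i)%:R.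
Proof. by rewrite mxE eqxx (inj_eq (@lshift_inj _ _)). Qed.

Lemma eL_x i j : eL K i 0 (rshift n j) = 0.
Proof. by rewrite mxE eq_rlshift andbF. Qed.

Lemma xL_e i j : xL K i 0 (lshift n j) = 0.
Proof. by rewrite mxE eq_lrshift andbF. Qed.

Lemma xL_x i j : xL K i 0 (rshift n j) = (j == i)%:R.
Proof. by rewrite mxE eqxx (inj_eq (@rshift_inj _ _)). Qed.

Definition coordE := (eL_e, eL_x, xL_e, xL_x).

Lemma lie_eL_xL i : lie (eL K i) (xL K i) = eL K i.
Proof.
apply: solvLP => j; rewrite ?lie_e ?lie_x !coordE ?mul0r ?subr0 //.
by case: (j == i); rewrite ?mulr1 ?mulr0.
Qed.

Variable D : {linear L -> L}.
Hypothesis halfD : half_derivation D.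

Lemma half_derivation_lie_x u v i : D (lie u v) 0 (rshift n i) = 0.
Proof. by rewrite halfD !mxE !lie_x addr0 mulr0. Qed.

Section OffPlane.
Hypothesis two_neq0 : 2%:R != 0 :> K.
Variables (u : L) (j : 'I_n).
Hypotheses (uej : u 0 (lshift n j) = 0) (uxj : u 0 (rshift n j) = 0).

(** Bracketing with e_j reads off the x_j-coordinate. *)
Lemma half_derivation_x_eq0 : D u 0 (rshift n j) = 0.
Proof.
have uj0 : lie u (eL K j) = 0.
  apply: solvLP => k; rewrite ?lie_e ?lie_x ?coordE mxE // mulr0 sub0r.
  by have [->|_] := eqVneq k j; rewrite ?uxj ?mul0r ?mulr0 oppr0.
have /rowP/(_ (lshift n j)) := half_derivation_commute _ _ _ _ _ two_neq0 halfD uj0.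
rewrite !mxE !lie_e !coordE uej uxj eqxx !mul0r mulr0 mulr1 subr0 addr0 sub0r.
by move/eqP; rewrite oppr_eq0 => /eqP.
Qed.

(** Bracketing with x_j reads off the e_j-coordinate. *)
Lemma half_derivation_e_eq0 : D u 0 (lshift n j) = 0.
Proof.
have uj0 : lie u (xL K j) = 0.
  apply: solvLP => k; rewrite ?lie_e ?lie_x ?coordE mxE // mulr0 subr0.
  by have [->|_] := eqVneq k j; rewrite ?uej ?mul0r ?mulr0.
have /rowP/(_ (lshift n j)) := half_derivation_commute _ _ _ _ _ two_neq0 halfD uj0.
by rewrite !mxE !lie_e !coordE uej uxj eqxx !mul0r mulr0 mulr1 !subr0 addr0.
Qed.

End OffPlane.

Lemma half_derivation_eL (two_neq0 : 2%:R != 0 :> K) i :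
  D (eL K i) = D (eL K i) 0 (lshift n i) *: eL K i.
Proof.
apply: solvLP => j; rewrite [RHS]mxE coordE; last first.
  by rewrite mulr0 -lie_eL_xL half_derivation_lie_x.
have [->|ji] := eqVneq j i; first by rewrite mulr1.
by rewrite mulr0 half_derivation_e_eq0 // coordE // (negPf ji).
Qed.

Lemma half_derivation_xL (two_neq0 : 2%:R != 0 :> K) i :
  D (xL K i) =
  D (xL K i) 0 (lshift n i) *: eL K i + D (xL K i) 0 (rshift n i) *: xL K i.
Proof.
apply: solvLP => j; rewrite [RHS]mxE [X in X + _]mxE [X in _ + X]mxE !coordE mulr0.
  rewrite addr0; have [->|ji] := eqVneq j i; first by rewrite mulr1.
  by rewrite mulr0 half_derivation_e_eq0 // coordE // (negPf ji).
rewrite add0r; have [->|ji] := eqVneq j i; first by rewrite mulr1.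
by rewrite mulr0 half_derivation_x_eq0 // coordE // (negPf ji).
Qed.

End HalfDerivationsOfSolvL.

Theorem theorem15 (R : realType) (n : nat) (hn : (1 <= n)%N)
    (Delta : {linear solvL R[i] n -> solvL R[i] n})
    (hDelta : local_half_derivation Delta) :
  exists a b c : 'I_n -> R[i], forall i : 'I_n,
    Delta (eL R[i] i) = a i *: eL R[i] i /\
    Delta (xL R[i] i) = b i *: eL R[i] i + c i *: xL R[i] i.
Proof.
have two_neq0 : 2%:R != 0 :> R[i] by rewrite Num.Theory.pnatr_eq0.
exists (fun i => Delta (eL R[i] i) 0 (lshift n i)).
exists (fun i => Delta (xL R[i] i) 0 (lshift n i)).
exists (fun i => Delta (xL R[i] i) 0 (rshift n i)) => i; split.
  have [D [halfD ->]] := hDelta (eL R[i] i).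
  exact: half_derivation_eL.
have [D [halfD ->]] := hDelta (xL R[i] i).
exact: half_derivation_xL.
Qed.
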